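(* Let $G=(\mathcal X,\mathcal E_G,w)$ be a finite connected weighted graph with induced distance $d_G$, and let $\mu,\nu$ be probability measures on $\mathcal X$ such that the pair $(\mu,\nu)$ is weakly non-degenerate, i.e. $\mu(\mathcal X')\neq\nu(\mathcal X')$ for every non-empty proper subset $\mathcal X'\subset\mathcal X$. Then the Kantorovich potential $u_G$ for the ground cost $d_G$ is unique up to an additive constant. Moreover, for any rooted spanning tree $T_\ast$ of $G$, with root $r$, satisfying $K_{d_{T_\ast}}(\mu,\nu)=\min_{T}K_{d_T}(\mu,\nu)$ (minimum over all rooted spanning trees $T$ of $G$), the Kantorovich potential is given (up to an additive constant) by $$u_G(y)=\sum_{x\,:\,y\lesssim x,\ x\neq r} d_{T_\ast}(x,x^{+})\,\operatorname{Sgn}\big(\Xi_{T_\ast}(x)\big),\qquad y\in\mathcal X,$$ where $\Xi_{T_\ast}(x)=\sum_{z\lesssim x}(\mu(z)-\nu(z))$.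
   Context: $\mathcal X$ is a finite set; $G=(\mathcal X,\mathcal E_G,w)$ is a connected graph with vertex set $\mathcal X$ and a symmetric weight function $w$ with $w(x,y)>0$ for every edge $\{x,y\}\in\mathcal E_G$, $x\ne y$, and $w(x,x)=0$. $d_G(x,y)$ is the minimal $w$-length of a path from $x$ to $y$ in $G$. For a set $\mathcal X'$, $\mu(\mathcal X')=\sum_{x\in\mathcal X'}\mu(x)$. For a distance $d$ on $\mathcal X$, the Kantorovich distance is $K_d(\mu,\nu)=\min_{\gamma\in\Pi(\mu,\nu)}\sum_{x,y}d(x,y)\gamma(x,y)$, where $\Pi(\mu,\nu)$ is the set of probability measures on $\mathcal X\times\mathcal X$ with first marginal $\mu$ and second marginal $\nu$. A Kantorovich (optimal dual) potential for the ground cost $d$ is a function $u:\mathcal X\to\mathbb R$ with $|u(x)-u(y)|\le d(x,y)$ for all $x,y$ that maximizes $\sum_x u(x)(\mu(x)-\nu(x))$ among all such functions. A rooted spanning tree $T$ of $G$ is a subgraph of $G$ that is a tree containing all vertices of $\mathcal X$, with a distinguished root $r\in\mathcal X$; its edges carry the weights $w$, and $d_T(x,y)$ is the $w$-length of the unique path from $x$ to $y$ in $T$ (so $d_T(x,y)=w(x,y)$ for each edge of $T$). For $x\neq r$, $x^+$ denotes the parent of $x$ (the neighbour of $x$ in $T$ on the path to $r$). $y\lesssim x$ means that $y$ is a descendant of $x$, i.e. $x$ lies on the path in $T$ from $y$ to $r$ (including $y=x$). $\operatorname{Sgn}$ is the usual sign function with values in $\{-1,+1\}$ (the value at $0$ is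 either $+1$ or $-1$). *)

(* Defs.v *)
From HB Require Import structures.
From mathcomp Require Import all_boot all_order all_algebra.
From mathcomp Require Import boolp classical_sets reals.

Set Implicit Arguments.
Unset Strict Implicit.
Unset Printing Implicit Defensive.

Import Order.TTheory GRing.Theory Num.Theory.
Local Open Scope ring_scope.

(* The weight is a total function; its values on distinct non-adjacent pairs
   are never used. *)
Record weighted_graph (R : realType) (X : finType) := WeightedGraph {
  edge : rel X ;
  weight : X -> X -> R ;
  edge_sym : symmetric edge ;
  edge_irr : irreflexive edge ;
  weight_sym : forall x y, weight x y = weight y x ;
  weight_gt0 : forall x y, edge x y -> 0 < weight x y ;
  weight_diag : forall x, weight x x = 0 }.

Section Graphs.
Variables (R : realType) (X : finType).
Implicit Types (e : rel X) (w : X -> X -> R) (x y : X) (p : seq X).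

Definition connected_rel e : Prop := forall x y, connect e x y.

Definition acyclic_rel e : Prop :=
  forall c : seq X, ucycle e c -> (size c <= 2)%N.

(* A path x, p_1, ..., p_k is represented by its start x and the list p of its
   other vertices; vertices are not repeated. *)
Definition simple_path e x y p : bool :=
  [&& path e x p, uniq (x :: p) & last x p == y].

Fixpoint path_length w x p : R :=
  if p is y :: p' then w x y + path_length w y p' else 0.

(* There are finitely many simple paths, so in a connected graph this infimum
   is a minimum. *)
Definition graph_dist (G : weighted_graph R X) x y : R :=
  inf [set l : R | exists2 p : seq X,
    simple_path (edge G) x y p & l = path_length (weight G) x p]%classic.

End Graphs.

Record rooted_spanning_tree (R : realType) (X : finType)
    (G : weighted_graph R X) := RootedSpanningTree {
  tree_edge : rel X ;
  root : X ;
  tree_sub : subrel tree_edge (edge G) ;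
  tree_sym : symmetric tree_edge ;
  tree_connected : connected_rel tree_edge ;
  tree_acyclic : acyclic_rel tree_edge }.

Section Trees.
Variables (R : realType) (X : finType) (G : weighted_graph R X).
Variable T : rooted_spanning_tree G.
Implicit Types x y z : X.

(* The unique simple path from x to y in T, without its first vertex x; the
   default value [::] of xget is never used. *)
Definition tree_path x y : seq X :=
  xget [::] [set p : seq X | simple_path (tree_edge T) x y p]%classic.

Definition tree_dist x y : R := path_length (weight G) x (tree_path x y).

(* Meaningful for x != root T only; the parent of the root is itself. *)
Definition parent x : X := head x (tree_path x (root T)).

Definition descendant y x : bool := x \in y :: tree_path y (root T).

End Trees.

Section Transport.
Variables (R : realType) (X : finType).
Implicit Types (d : X -> X -> R) (mu nu u v : X -> R).

Definition prob_measure (Y : finType) (m : Y -> R) : Prop :=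
  (forall y, 0 <= m y) /\ \sum_y m y = 1.

Definition mass mu (A : {set X}) : R := \sum_(x in A) mu x.

Definition weakly_nondegenerate mu nu : Prop :=
  forall A : {set X}, A != finset.set0 -> A != [set: X]%SET ->
    mass mu A != mass nu A.

Definition coupling mu nu (gamma : X * X -> R) : Prop :=
  [/\ prob_measure gamma,
      forall x, \sum_y gamma (x, y) = mu x &
      forall y, \sum_x gamma (x, y) = nu y].

Definition transport_cost d (gamma : X * X -> R) : R :=
  \sum_x \sum_y d x y * gamma (x, y).

(* For probability measures the couplings form a nonempty compact set and the
   cost is linear, so this infimum is a minimum. *)
Definition kantorovich d mu nu : R :=
  inf [set c : R | exists2 gamma : X * X -> R,
    coupling mu nu gamma & c = transport_cost d gamma]%classic.

Definition lipschitz1 d u : Prop := forall x y, `|u x - u y| <= d x y.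

Definition dual_value mu nu u : R := \sum_x u x * (mu x - nu x).

Definition kantorovich_potential d mu nu u : Prop :=
  lipschitz1 d u /\
  forall v, lipschitz1 d v -> dual_value mu nu v <= dual_value mu nu u.

Definition optimal_tree (G : weighted_graph R X) mu nu
    (T : rooted_spanning_tree G) : Prop :=
  forall T' : rooted_spanning_tree G,
    kantorovich (tree_dist T) mu nu <= kantorovich (tree_dist T') mu nu.

Definition tree_flow (G : weighted_graph R X) (T : rooted_spanning_tree G)
    mu nu (x : X) : R :=
  \sum_(z | descendant T z x) (mu z - nu z).

(* The sign function with values in {-1, +1}; b selects the value
   (-1) ^+ b at 0. *)
Definition pm_sgn (b : bool) (a : R) : R :=
  if a == 0 then (-1) ^+ b else Num.sg a.

Definition tree_potential (G : weighted_graph R X) (T : rooted_spanning_tree G)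
    mu nu (b : bool) (y : X) : R :=
  \sum_(x | descendant T y x && (x != root T))
    tree_dist T x (parent T x) * pm_sgn b (tree_flow T mu nu x).

End Transport.

(* Main.v *)
Require Import Defs.
From HB Require Import structures.
From mathcomp Require Import all_boot all_order all_algebra.
From mathcomp Require Import boolp classical_sets reals.
From mathcomp Require Import ring lra.

Set Implicit Arguments.
Unset Strict Implicit.
Unset Printing Implicit Defensive.

Import Order.TTheory GRing.Theory Num.Theory.
Local Open Scope ring_scope.

(* Let f = mu - nu and, for a spanning tree T, let Xi be its subtree sums of f.
   Abel summation along T turns the dual value of v into
   sum_{x <> r} (v x - v x^+) Xi x, so C(T) = sum_{x <> r} w(x, x^+) |Xi x|
   bounds the dual value of every v that is 1-Lipschitz on the edges of T, and,
   as Xi x <> 0 by non-degeneracy, equality forces v = u_T + const, where u_T is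
   the potential of the theorem. It thus suffices that, for an optimal T, u_T is
   1-Lipschitz on every edge of G. Cycle cancelling replaces any flow on G with
   divergence f by one at most as costly whose support has no cycle and, by
   non-degeneracy, is connected: it is a spanning tree T', so K_{d_T'}, and with
   it C(T) <= K_{d_T}, is at most the cost of the flow. Apply this to the
   tree flow of T perturbed by a small amount sent through an edge {a, c} of G
   and back along T: the first-order change of its cost, proportional to
   w(a, c) - (u_T(a) - u_T(c)), has to be nonnegative. *)

(** * Simple paths and their uniqueness in acyclic graphs *)

Section SimplePaths.
Variables (X : finType) (e : rel X).
Hypotheses (e_sym : symmetric e) (e_irr : irreflexive e).

Lemma simple_path_cons (x y z : X) (p : seq X) :
  simple_path e x y (z :: p) = [&& e x z, x \notin z :: p & simple_path e z y p].
Proof.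
rewrite /simple_path [path _ _ _]/= [uniq (x :: _)]/= [last _ _]/=.
by case: (e x z); case: (path e z p); case: (x \notin _); rewrite ?andbF.
Qed.

Lemma simple_path_nil (x y : X) : simple_path e x y [::] = (x == y).
Proof. by []. Qed.

Lemma simple_path_refl (x : X) (p : seq X) : simple_path e x x p -> p = [::].
Proof.
case: p => [//|z p] /and3P[_ /= /andP[xzp _] /eqP lastx].
by move: xzp; rewrite -[X in X \notin _]lastx mem_last.
Qed.

Lemma simple_path_suffix (x y z : X) (p : seq X) :
  simple_path e x y p -> z \in p ->
  exists p1 p2, p = p1 ++ z :: p2 /\ simple_path e z y p2.
Proof.
move=> + zp; case/splitPr: zp => p1 p2 /and3P[].
rewrite cat_path /= => /and3P[_ _ pz] /andP[_].
rewrite cat_uniq => /and3P[_ _ uz]; rewrite last_cat /= => lz.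
by exists p1, p2; split=> //; apply/and3P.
Qed.

(* If two simple paths from x split at once, into a and b, a path from a to b
   avoiding x closes up to a cycle. *)
Lemma simple_path_unique (acyc : acyclic_rel e) (x y : X) (p q : seq X) :
  simple_path e x y p -> simple_path e x y q -> p = q.
Proof.
elim: p x q => [|a p IHp] x [|b q] //.
- by rewrite simple_path_nil => /eqP<- /simple_path_refl.
- by rewrite simple_path_nil => + /eqP xy; rewrite -xy => /simple_path_refl.
rewrite !simple_path_cons => /and3P[xa xp sp] /and3P[xb xq sq].
have [ab|ab] := eqVneq a b.
  by move: sq; rewrite -ab => /(IHp _ _ sp) ->.
(* The graph with [x] removed: [a] and [b] both reach [y] in it, because the tails of the two simple
   paths avoid [x]. *)
pose e' := [rel u v | [&& e u v, u != x & v != x]].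
have e'_sym : symmetric e'.
  by move=> u v /=; rewrite e_sym; congr (_ && _); rewrite andbC.
have conn c s : x \notin c :: s -> simple_path e c y s -> connect e' c y.
  move=> xs /and3P[ps _ /eqP <-]; apply/connectP; exists s => //.
  elim: s c xs ps => [//|d s IHs] c; rewrite !inE !negb_or.
  move=> /and3P[xc xd xs] /= /andP[cd ds].
  by rewrite cd eq_sym xc eq_sym xd /= IHs // inE negb_or xd.
have : connect e' a b.
  apply: connect_trans (conn _ _ xp sp) _.
  by rewrite (sym_connect_sym e'_sym) (conn _ _ xq).
case/connectP=> s0 /shortenP[s ps us _] bs.
(* As [a] and [b] differ, the connecting path has an edge, so the cycle [x :: a :: s] has at least
   three vertices. *)
have s_gt0 : (0 < size s)%N.
  by case: s bs {ps us} => [/= ba|//]; rewrite ba eqxx in ab.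
suff /acyc : ucycle e (x :: a :: s) by rewrite /= ltnS ltnNge s_gt0.
apply/andP; split.
  rewrite /= xa rcons_path -bs e_sym xb andbT.
  by apply: sub_path ps => u v /and3P[].
rewrite cons_uniq us andbT.
have xa' : a != x by apply: contraTneq xa => ->; rewrite e_irr.
have : all (predC1 x) (a :: s).
  rewrite /= xa' /=; elim: s a ps {xa us bs ab xa' s_gt0 sp xp} => //= c s IHs a.
  by move=> /andP[/and3P[_ _ ->]] /IHs.
by move/allP=> h; apply/negP => /h /=; rewrite eqxx.
Qed.

End SimplePaths.

(** * Path lengths and increments of functions along paths *)

Lemma path_length_ge_diff (R : realType) (X : finType) (e : rel X)
    (w : X -> X -> R) (u : X -> R) (x : X) (p : seq X) :
  (forall a b, e a b -> `|u a - u b| <= w a b) -> path e x p ->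
  `|u x - u (last x p)| <= path_length w x p.
Proof.
move=> lip; elim: p x => [|y p IHp] x /=; first by rewrite subrr normr0.
move=> /andP[xy /IHp]; have := lip _ _ xy.
have := ler_normD (u x - u y) (u y - u (last y p)).
by rewrite addrA subrK; lra.
Qed.

Lemma path_length_ge0 (R : realType) (X : finType) (e : rel X)
    (w : X -> X -> R) (x : X) (p : seq X) :
  (forall a b, e a b -> 0 <= w a b) -> path e x p -> 0 <= path_length w x p.
Proof.
move=> w_ge0 pp; apply: le_trans (normr_ge0 (0 - 0)) _.
apply: (path_length_ge_diff (u := fun=> 0) _ pp) => a b /w_ge0.
by rewrite subrr normr0.
Qed.

Lemma path_length_cat (R : realType) (X : finType) (w : X -> X -> R)
    (x : X) (p q : seq X) :
  path_length w x (p ++ q) = path_length w x p + path_length w (last x p) q.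
Proof. by elim: p x => [|y p IHp] x /=; rewrite ?add0r // IHp addrA. Qed.

(** * Paths, distances and subtree sums in a rooted spanning tree *)

Section TreePaths.
Variables (R : realType) (X : finType) (G : weighted_graph R X).
Variable T : rooted_spanning_tree G.
Local Notation r := (Defs.root T).
Local Notation w := (weight G).
Local Notation p_ := (fun x => tree_path T x r).

Lemma tree_irr : irreflexive (tree_edge T).
Proof. by move=> x; apply/negP => /(tree_sub (r:=T)); rewrite edge_irr. Qed.

Lemma weight_tree_ge0 (x y : X) : tree_edge T x y -> 0 <= w x y.
Proof. by move=> /(tree_sub (r:=T)) /weight_gt0 /ltW. Qed.

Lemma tree_pathP (x y : X) : simple_path (tree_edge T) x y (tree_path T x y).
Proof.
have /connectP[p0 /shortenP[p pp up _] yp] := tree_connected T x y.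
apply: (@xgetPex _ [::] (fun p => simple_path (tree_edge T) x y p)).
by exists p; apply/and3P; split=> //; rewrite yp.
Qed.

(** This is how [tree_path] gets computed below: exhibit a simple path with the right ends. *)
Lemma tree_path_eq (x y : X) (p : seq X) :
  simple_path (tree_edge T) x y p -> tree_path T x y = p.
Proof.
exact: (simple_path_unique (tree_sym T) tree_irr (tree_acyclic (r:=T))
  (tree_pathP x y)).
Qed.

Lemma tree_pathxx (x : X) : tree_path T x x = [::].
Proof. by apply: tree_path_eq; rewrite simple_path_nil. Qed.

Lemma tree_path_root (x : X) : x != r ->
  tree_path T x r = parent T x :: tree_path T (parent T x) r.
Proof.
move=> xr; have := tree_pathP x r; rewrite /parent.
case: (tree_path T x r) => [|y p] /=; first by rewrite simple_path_nil (negPf xr).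
by rewrite simple_path_cons => /and3P[_ _ /tree_path_eq ->].
Qed.

Lemma tree_edge_parent (x : X) : x != r -> tree_edge T x (parent T x).
Proof.
move=> /tree_path_root xE; have := tree_pathP x r.
by rewrite xE simple_path_cons => /and3P[].
Qed.

Lemma notin_tree_path_parent (x : X) : x != r ->
  x \notin parent T x :: tree_path T (parent T x) r.
Proof.
move=> /tree_path_root xE; have := tree_pathP x r.
by rewrite xE simple_path_cons => /and3P[].
Qed.

Lemma descendant_root (x : X) : descendant T r x = (x == r).
Proof. by rewrite /descendant tree_pathxx inE. Qed.

Lemma descendant_refl (x : X) : descendant T x x.
Proof. exact: mem_head. Qed.

Lemma descendant_parent (x y : X) : y != r ->
  descendant T y x = (x == y) || descendant T (parent T y) x.
Proof. by move=> yr; rewrite /descendant {1}(tree_path_root yr) inE. Qed.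

(** If [y] lies on the path from [x] to the root, the edge followed by the tail from [y] is again
    simple, hence is that path. Otherwise prepending [y] to the path from [x] gives the path from
    [y]. *)
Lemma tree_edge_cases (x y : X) : tree_edge T x y ->
  (x != r /\ y = parent T x) \/ (y != r /\ x = parent T y).
Proof.
move=> xy; have yx : tree_edge T y x by rewrite tree_sym.
have [yx0|yNx0] := boolP (y \in x :: tree_path T x r).
  left; move: yx0; rewrite inE => /predU1P[yx'|yp].
    by rewrite yx' tree_irr in xy.
  have [p1 [p2 [pE sp2]]] := simple_path_suffix (tree_pathP x r) yp.
  suff /tree_path_eq xE : simple_path (tree_edge T) x r (y :: p2).
    split; last by rewrite /parent xE.
    by apply: contra_eq_neq xE => ->; rewrite tree_pathxx.
  rewrite simple_path_cons xy sp2 andbT /=.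
  have /and3P[_ + _] := tree_pathP x r.
  by rewrite pE /= mem_cat negb_or => /andP[/andP[]].
right; have /tree_path_eq yE : simple_path (tree_edge T) y r (x :: tree_path T x r).
  by rewrite simple_path_cons yx yNx0 tree_pathP.
split; last by rewrite /parent yE.
by apply: contra_eq_neq yE => ->; rewrite tree_pathxx.
Qed.

Lemma tree_distxx (x : X) : tree_dist T x x = 0.
Proof. by rewrite /tree_dist tree_pathxx. Qed.

Lemma tree_dist_ge0 (x y : X) : 0 <= tree_dist T x y.
Proof.
have /and3P[pp _ _] := tree_pathP x y.
exact: path_length_ge0 weight_tree_ge0 pp.
Qed.

Lemma tree_dist_edge (x y : X) : tree_edge T x y -> tree_dist T x y = w x y.
Proof.
move=> xy; rewrite /tree_dist (@tree_path_eq _ _ [:: y]) /= ?addr0 //.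
rewrite simple_path_cons xy simple_path_nil eqxx inE andbT /=.
by apply: contraTneq xy => ->; rewrite tree_irr.
Qed.

(** Either [x] can be prepended to the path from [z] to [y], or it lies on that path, and the path
    from [x] is then a tail of it. *)
Lemma tree_dist_step (x y z : X) : tree_edge T x z ->
  tree_dist T x y <= w x z + tree_dist T z y.
Proof.
move=> xz; have szy := tree_pathP z y.
have [xp|xNp] := boolP (x \in z :: tree_path T z y); last first.
  rewrite {1}/tree_dist (@tree_path_eq _ _ (z :: tree_path T z y)) //.
  by rewrite simple_path_cons xz xNp.
move: xp; rewrite inE => /predU1P[xz'|]; first by rewrite xz' tree_irr in xz.
move=> /(simple_path_suffix szy)[p1 [p2 [pE /tree_path_eq xE]]].
rewrite {2}/tree_dist pE -cat_rcons path_length_cat last_rcons -{1}xE.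
have /and3P[] := szy; rewrite pE -cat_rcons cat_path => /andP[pp _] _ _.
have := path_length_ge0 weight_tree_ge0 pp; have := weight_tree_ge0 xz.
by rewrite /tree_dist; lra.
Qed.

Lemma tree_dist_triangle (x y z : X) :
  tree_dist T x z <= tree_dist T x y + tree_dist T y z.
Proof.
have /and3P[pp _ /eqP yE] := tree_pathP x y.
rewrite {2}/tree_dist -{2}yE.
move: (tree_path T x y) pp => p {yE}; elim: p x => [|a p IHp] b /=.
  by rewrite add0r.
by move=> /andP[/(tree_dist_step z) ba /IHp]; lra.
Qed.

Lemma tree_dist_parent (x : X) : x != r ->
  tree_dist T x (parent T x) = w x (parent T x).
Proof. by move=> /tree_edge_parent /tree_dist_edge. Qed.

(** Induction on the depth, the number of edges on the path to the root. *)
Lemma tree_ind (P : X -> Prop) :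
  P r -> (forall x, x != r -> P (parent T x) -> P x) -> forall x, P x.
Proof.
move=> Pr Pstep x; move: {2}(size _) (erefl (size (tree_path T x r))) => n.
elim: n x => [|n IHn] x; have [->//|xr] := eqVneq x r;
  rewrite (tree_path_root xr) // => -[/IHn]; exact: Pstep.
Qed.

Lemma sum_descendant_parent (F : X -> R) (y : X) : y != r ->
  \sum_(x | descendant T y x && (x != r)) F x =
  F y + \sum_(x | descendant T (parent T y) x && (x != r)) F x.
Proof.
move=> yr; rewrite (bigD1 y) /= ?descendant_refl ?yr //; congr (_ + _).
apply: eq_bigl => x; rewrite descendant_parent //.
have [->|xy] /= := eqVneq x y; last by rewrite andbT.
rewrite andbF; apply/esym; rewrite yr andbT; apply: negPf.
exact: notin_tree_path_parent.
Qed.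

Lemma sum_descendant_telescope (v : X -> R) (y : X) :
  \sum_(x | descendant T y x && (x != r)) (v x - v (parent T x)) = v y - v r.
Proof.
elim/tree_ind: y => [|y yr IHy].
  rewrite subrr big_pred0 // => x.
  by rewrite descendant_root; case: eqP.
by rewrite sum_descendant_parent // IHy; lra.
Qed.

(** This is [tree_flow] for an arbitrary [g]; perturbations of [mu - nu] are fed to it later. *)
Definition subtree_sum (g : X -> R) (x : X) : R :=
  \sum_(z | descendant T z x) g z.

(** As [g] has total zero, [v] may be replaced by [v - v r], which telescopes along the path to the
    root. Exchanging the sums collects [g] over the descendants of each [x]. *)
Lemma sum_by_parts (v g : X -> R) : \sum_x g x = 0 ->
  \sum_x v x * g x = \sum_(x | x != r) (v x - v (parent T x)) * subtree_sum g x.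
Proof.
move=> g0; transitivity (\sum_x (v x - v r) * g x).
  under [RHS]eq_bigr do rewrite mulrBl.
  by rewrite big_split /= sumrN -mulr_sumr g0 mulr0 subr0.
under eq_bigr do rewrite -sum_descendant_telescope mulr_suml.
rewrite (exchange_big_dep (fun x => x != r)) /=; last by move=> y x _ /andP[].
apply: eq_bigr => x xr; rewrite /subtree_sum mulr_sumr.
by apply: eq_bigl => y; rewrite xr andbT.
Qed.

End TreePaths.

(** * Flows with prescribed divergence *)

Section Flows.
Variables (R : realType) (X : finType).
Implicit Types (e : rel X) (g : X -> R) (phi chi : X -> X -> R).

(** [phi x y] is the net amount sent from [x] to [y]; antisymmetry encodes an oriented flow on an
    undirected graph. *)
Record is_flow e g phi : Prop := IsFlow {
  flow_anti : forall x y, phi y x = - phi x y ;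
  flow_supp : forall x y, phi x y != 0 -> e x y ;
  flow_div : forall x, \sum_y phi x y = g x }.

(** Each edge is counted in both orientations, whence the factors 2 below. *)
Definition flow_cost (w phi : X -> X -> R) : R :=
  \sum_x \sum_y w x y * `|phi x y|.

Lemma is_flow_ext e g g' phi : g =1 g' -> is_flow e g phi -> is_flow e g' phi.
Proof. by move=> gg' [anti supp div]; split=> // x; rewrite div gg'. Qed.

Lemma is_flow0 e : is_flow e (fun=> 0) (fun _ _ => 0).
Proof. by split=> [x y|x y|x]; rewrite ?oppr0 ?eqxx ?big1. Qed.

Lemma is_flowD e g1 g2 phi1 phi2 : is_flow e g1 phi1 -> is_flow e g2 phi2 ->
  is_flow e (fun x => g1 x + g2 x) (fun x y => phi1 x y + phi2 x y).
Proof.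
move=> [a1 s1 d1] [a2 s2 d2]; split=> [x y|x y|x].
- by rewrite a1 a2 opprD.
- by have [->|/s1 //] := eqVneq (phi1 x y) 0; rewrite add0r => /s2.
- by rewrite big_split /= d1 d2.
Qed.

Lemma is_flowZ e g phi (t : R) : is_flow e g phi ->
  is_flow e (fun x => t * g x) (fun x y => t * phi x y).
Proof.
move=> [a s d]; split=> [x y|x y|x].
- by rewrite a mulrN.
- by rewrite mulf_eq0 negb_or => /andP[_ /s].
- by rewrite -mulr_sumr d.
Qed.

Lemma is_flow_sum e (g_ : X -> X -> R) (phi_ : X -> X -> X -> R) (s : seq X) :
  (forall i, is_flow e (g_ i) (phi_ i)) ->
  is_flow e (fun x => \sum_(i <- s) g_ i x)
            (fun x y => \sum_(i <- s) phi_ i x y).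
Proof.
move=> flow_; split=> [x y|x y|x].
- by rewrite -sumrN; apply: eq_bigr => i _; rewrite (flow_anti (flow_ i)).
- apply: contraNT => xy; rewrite big1 // => i _; apply/eqP; apply: contraNT xy.
  exact: (flow_supp (flow_ i)).
- by rewrite exchange_big; apply: eq_bigr => i _; rewrite (flow_div (flow_ i)).
Qed.

Lemma is_flow_edge e (a b : X) : symmetric e -> e a b ->
  is_flow e (fun x => (x == a)%:R - (x == b)%:R)
    (fun x y => ((x == a) && (y == b))%:R - ((x == b) && (y == a))%:R).
Proof.
move=> e_sym ab; split=> [x y|x y|x].
- by rewrite opprB andbC [in X in _ - X]andbC.
- case: andP => [[/eqP-> /eqP->]//|_]; case: andP => [[/eqP-> /eqP->]|].
    by rewrite e_sym.
  by rewrite subrr eqxx.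
- rewrite big_split /= sumrN; congr (_ - _).
    rewrite (bigD1 b) //= eqxx andbT big1 ?addr0 // => y /negPf->.
    by rewrite andbF.
  rewrite (bigD1 a) //= eqxx andbT big1 ?addr0 // => y /negPf->.
  by rewrite andbF.
Qed.

Lemma sum_pick_eq (F : X -> R) (a : X) : \sum_x (x == a)%:R * F x = F a.
Proof.
rewrite (bigD1 a) //= eqxx mul1r big1 ?addr0 // => x /negPf->.
by rewrite mul0r.
Qed.

(** Each vertex [a] sends [g a] along a path to one fixed vertex [r]; what accumulates at [r] has
    total zero. *)
Lemma exists_flow e g : symmetric e -> connected_rel e -> \sum_x g x = 0 ->
  exists phi, is_flow e g phi.
Proof.
move=> e_sym conn g0; have [r _|X0] := pickP (@predT X); last first.
  by exists (fun _ _ => 0); apply: is_flow_ext (is_flow0 _) => x; have := X0 x.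
have unit_flow a : exists phi,
    is_flow e (fun x => (x == a)%:R - (x == r)%:R) phi.
  have /connectP[p pp ->] := conn a r; elim: p a pp => [|b p IHp] a /=.
    move=> _; exists (fun _ _ => 0); apply: is_flow_ext (is_flow0 _) => x.
    by rewrite subrr.
  move=> /andP[ab /IHp[phi phi_flow]].
  have := is_flowD (is_flow_edge e_sym ab) phi_flow.
  move=> /(is_flow_ext (g' := fun x => (x == a)%:R - (x == last b p)%:R)) fl.
  by eexists; apply: fl => x; lra.
have [phi_ phi_flow] := choice unit_flow.
exists (fun x y => \sum_a g a * phi_ a x y).
apply: is_flow_ext (is_flow_sum _ (fun a => is_flowZ (g a) (phi_flow a))) => x /=.
under eq_bigr do rewrite mulrBr [x == _]eq_sym.
rewrite big_split /= sumrN -mulr_suml g0 mul0r subr0.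
by under eq_bigr do rewrite mulrC; rewrite sum_pick_eq.
Qed.

(** Exchanging the two sums changes the total into its opposite. *)
Lemma antisym_sum0 (F : X -> X -> R) (P : pred X) :
  (forall x y, F y x = - F x y) -> \sum_(x | P x) \sum_(y | P y) F x y = 0.
Proof.
move=> antiF; set S := LHS; suff : S = - S by lra.
rewrite {1}/S exchange_big /= -sumrN; apply: eq_bigr => x _.
by rewrite -sumrN; apply: eq_bigr => y _; rewrite antiF.
Qed.

End Flows.

(** * Flows along the parent edges of a tree, and their cost *)

Section ParentFlow.
Variables (R : realType) (X : finType) (G : weighted_graph R X).
Variable T : rooted_spanning_tree G.
Local Notation r := (Defs.root T).

Definition parent_flow (s : X -> R) (x y : X) : R :=
  ((x != r) && (y == parent T x))%:R * s x
  - ((y != r) && (x == parent T y))%:R * s y.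

(** The divergence at [x] results from summation by parts against the indicator function of [x]. *)
Lemma parent_flowP (g : X -> R) : \sum_x g x = 0 ->
  is_flow (tree_edge T) g (parent_flow (subtree_sum T g)).
Proof.
move=> g0; split=> [x y|x y|x].
- by rewrite /parent_flow opprB.
- rewrite /parent_flow; case: andP => [[/tree_edge_parent xr /eqP->]//|_].
  case: andP => [[/tree_edge_parent yr /eqP->]|_]; first by rewrite tree_sym.
  by rewrite !mul0r subrr eqxx.
- rewrite -[RHS](sum_pick_eq g) (sum_by_parts T) // /parent_flow big_split sumrN /=.
  under [RHS]eq_bigr do rewrite mulrBl.
  rewrite [RHS]big_split sumrN /=; congr (_ - _).
    rewrite (bigD1 (parent T x)) //= eqxx andbT [X in _ + X]big1 ?addr0; last first.
      by move=> y /negPf->; rewrite andbF mul0r.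
    have [->|xr] := eqVneq x r.
      by rewrite big1 ?mul0r // => y /negPf->; rewrite mul0r.
    rewrite (bigD1 x) //= eqxx big1 ?addr0 // => y /andP[_ /negPf->].
    by rewrite mul0r.
  rewrite [RHS]big_mkcond; apply: eq_bigr => y _; rewrite [x == _]eq_sym.
  by case: (y != r); rewrite /= ?mul0r.
Qed.

(** For [g = mu - nu] this is C(T). Each tree edge counts once, unlike in [flow_cost]. *)
Definition tree_cost (g : X -> R) : R :=
  \sum_(x | x != r) weight G x (parent T x) * `|subtree_sum T g x|.

(** The triangle inequality separates the two orientations, which avoids excluding that two vertices
    are the parents of each other. *)
Lemma sum_parent_flow_cost (s : X -> R) :
  flow_cost (weight G) (parent_flow s) <=
  2 * \sum_(x | x != r) weight G x (parent T x) * `|s x|.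
Proof.
pose F x y := ((x != r) && (y == parent T x))%:R * (weight G x y * `|s x|).
have sumF : \sum_x \sum_y F x y =
    \sum_(x | x != r) weight G x (parent T x) * `|s x|.
  rewrite [RHS]big_mkcond; apply: eq_bigr => x _.
  rewrite (bigD1 (parent T x)) //= /F eqxx andbT big1 ?addr0.
    by case: (x != r); rewrite ?mul1r ?mul0r.
  by move=> y /negPf->; rewrite andbF mul0r.
rewrite -sumF mulr_natl mulr2n {2}exchange_big -big_split; apply: ler_sum => x _.
rewrite -big_split; apply: ler_sum => y _ /=; rewrite /F (weight_sym G y x).
rewrite /parent_flow; case: andP => [[/tree_edge_parent xy /eqP->]|_].
  rewrite !mul1r; have := weight_tree_ge0 xy; case: (_ && _) => w_ge0.
    rewrite !mul1r -mulrDr ler_wpM2l //; exact: ler_normB.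
  by rewrite !mul0r !addr0 subr0.
by case: (_ && _); rewrite !mul0r ?mul1r ?add0r ?oppr0 ?normrN ?normr0 ?mulr0 ?addr0.
Qed.

End ParentFlow.

(** * From transshipment plans to couplings *)

Section Transshipment.
Variables (R : realType) (X : finType) (d : X -> X -> R).
Hypotheses (dxx : forall x, d x x = 0) (d_ge0 : forall x y, 0 <= d x y).
Hypothesis d_triangle : forall x y z, d x z <= d x y + d y z.
Implicit Types (mu nu : X -> R) (gamma : X -> X -> R).

(** The diagonal is left out: mass that stays put is free, and is fixed at the end to get the right
    marginals. *)
Definition outflow gamma (x : X) : R := \sum_(y | y != x) gamma x y.
Definition inflow gamma (x : X) : R := \sum_(y | y != x) gamma y x.

Lemma sum2_split_at (z : X) (F : X -> X -> R) :
  \sum_x \sum_y F x y = F z z + \sum_(y | y != z) F z y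
    + \sum_(x | x != z) F x z + \sum_(x | x != z) \sum_(y | y != z) F x y.
Proof.
rewrite (bigD1 z) //= (bigD1 z) //= -[RHS]addrA; congr (_ + _).
by rewrite -big_split; apply: eq_bigr => x _; rewrite (bigD1 z).
Qed.

(* Rerouting x -> z -> y directly as x -> y lowers the throughput of z without
   raising the cost. *)
Lemma bypass_vertex mu nu gamma (z : X) :
  (forall x, 0 <= mu x) -> (forall x, 0 <= nu x) ->
  (forall x y, 0 <= gamma x y) ->
  (forall x, outflow gamma x - inflow gamma x = mu x - nu x) ->
  exists gamma',
  [/\ forall x y, 0 <= gamma' x y,
      forall x, outflow gamma' x - inflow gamma' x = mu x - nu x,
      outflow gamma' z <= mu z,
      forall x, outflow gamma' x <= outflow gamma x &
      \sum_x \sum_y d x y * gamma' x y <= \sum_x \sum_y d x y * gamma x y].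
Proof.
move=> mu_ge0 nu_ge0 gamma_ge0 bal.
have [small|big] := leP (outflow gamma z) (mu z); first by exists gamma.
set O := outflow gamma z in big *; set I := inflow gamma z.
have OI : O - I = mu z - nu z by exact: bal.
pose delta := O - mu z.
have delta_gt0 : 0 < delta by rewrite subr_gt0.
have O_gt0 : 0 < O by apply: le_lt_trans big.
have I_gt0 : 0 < I by have := nu_ge0 z; rewrite /delta in delta_gt0; lra.
(* The excess [delta] is removed from the outflow of [z] by the fraction [a] and from its inflow by
   the fraction [b]. The pair (x, y) receives the share [k * (gamma x z * gamma z y)], and these
   shares add up to [k * I * O = delta]. *)
pose a := delta / O; pose b := delta / I; pose k := delta / (I * O).
have kI : k * I = a by rewrite /k /a; field; rewrite !gt_eqF.
have kO : k * O = b by rewrite /k /b; field; rewrite !gt_eqF.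
have k_ge0 : 0 <= k by rewrite divr_ge0 ?mulr_ge0 ?ltW.
have aO : a * O = delta by rewrite divfK // gt_eqF.
have bI : b * I = delta by rewrite divfK // gt_eqF.
have a_le1 : a <= 1 by rewrite ler_pdivrMr // mul1r /delta gerBl.
have b_le1 : b <= 1.
  by rewrite ler_pdivrMr // mul1r; have := nu_ge0 z; rewrite /delta; lra.
pose gamma' x y := if x == z then (1 - a) * gamma z y
  else if y == z then (1 - b) * gamma x z
  else gamma x y + k * (gamma x z * gamma z y).
have g'zy y : gamma' z y = (1 - a) * gamma z y by rewrite /gamma' eqxx.
have g'xz x : x != z -> gamma' x z = (1 - b) * gamma x z.
  by rewrite /gamma' eqxx => /negPf->.
have g'xy x y : x != z -> y != z ->
    gamma' x y = gamma x y + k * (gamma x z * gamma z y).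
  by rewrite /gamma' => /negPf-> /negPf->.
have outz : outflow gamma' z = mu z.
  rewrite /outflow (eq_bigr _ (fun y _ => g'zy y)) -mulr_sumr -/(outflow _ _) -/O.
  by rewrite mulrBl mul1r aO /delta; lra.
have inz : inflow gamma' z = nu z.
  rewrite /inflow (eq_bigr _ g'xz) -mulr_sumr -/(inflow _ _) -/I.
  by rewrite mulrBl mul1r bI /delta; lra.
(* The correction is the rerouted mass that went from [x] to [z] and back: it now sits on the
   diagonal, which [outflow] ignores. *)
have outx x : x != z -> outflow gamma' x = outflow gamma x - k * (gamma x z * gamma z x).
  move=> xz; rewrite /outflow (bigD1 z) 1?eq_sym //= g'xz //.
  rewrite [in RHS](bigD1 z) 1?eq_sym //=.
  rewrite (eq_bigr (fun y => gamma x y + (k * gamma x z) * gamma z y)); last first.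
    by move=> y /andP[_ yz]; rewrite g'xy // mulrA.
  rewrite big_split -mulr_sumr /=; set S := \sum_(y | _) gamma z y.
  have -> : S = O - gamma z x.
    rewrite /O /outflow (bigD1 x) //= addrAC subrr add0r.
    by apply: eq_bigl => y; rewrite andbC.
  by rewrite -kO; ring.
have inx x : x != z -> inflow gamma' x = inflow gamma x - k * (gamma x z * gamma z x).
  move=> xz; rewrite /inflow (bigD1 z) 1?eq_sym //= g'zy.
  rewrite [in RHS](bigD1 z) 1?eq_sym //=.
  rewrite (eq_bigr (fun y => gamma y x + (k * gamma z x) * gamma y z)); last first.
    by move=> y /andP[_ yz]; rewrite g'xy //; ring.
  rewrite big_split -mulr_sumr /=; set S := \sum_(y | _) gamma y z.
  have -> : S = I - gamma x z.
    rewrite /I /inflow (bigD1 x) //= addrAC subrr add0r.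
    by apply: eq_bigl => y; rewrite andbC.
  by rewrite -kI; ring.
exists gamma'; split=> [x y|x||x|].
- have [->|xz] := eqVneq x z; first by rewrite g'zy mulr_ge0 // subr_ge0.
  have [->|yz] := eqVneq y z; first by rewrite g'xz // mulr_ge0 // subr_ge0.
  by rewrite g'xy // addr_ge0 // mulr_ge0 // mulr_ge0.
- have [->|xz] := eqVneq x z; first by rewrite outz inz.
  by rewrite outx // inx // -bal; lra.
- by rewrite outz.
- have [->|xz] := eqVneq x z; first by rewrite outz ltW.
  by rewrite outx // gerBl mulr_ge0 // mulr_ge0.
rewrite (sum2_split_at z) [leRHS](sum2_split_at z) dxx !mul0r !add0r.
under eq_bigr do rewrite g'zy mulrCA.
under [X in _ + X + _]eq_bigr => x xz do rewrite g'xz // mulrCA.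
rewrite -!mulr_sumr.
set Cz := \sum_(y | _) d z y * _; set Dz := \sum_(x | _) d x z * _.
set S := \sum_(x | _) \sum_(y | _) _.
set S0 := \sum_(x | _) \sum_(y | _) d x y * gamma x y.
suff : S <= S0 + (b * Dz + a * Cz) by lra.
apply: (@le_trans _ _ (S0 + \sum_(x | x != z) \sum_(y | y != z)
    ((k * gamma z y) * (d x z * gamma x z) + (k * gamma x z) * (d z y * gamma z y)))).
  rewrite -big_split; apply: ler_sum => x xz; rewrite -big_split.
  apply: ler_sum => y yz /=; rewrite g'xy // mulrDr lerD2l.
  have -> : k * gamma z y * (d x z * gamma x z) + k * gamma x z * (d z y * gamma z y)
     = (d x z + d z y) * (k * (gamma x z * gamma z y)) by ring.
  by rewrite ler_wpM2r // mulr_ge0 // mulr_ge0.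
rewrite lerD2l le_eqVlt; apply/orP; left; apply/eqP.
under eq_bigr do rewrite big_split -mulr_suml -!mulr_sumr.
by rewrite big_split /= -mulr_suml -!mulr_sumr -/O -/I kO kI.
Qed.

(** The bound obtained at one vertex survives the later steps, as these raise no outflow. *)
Lemma bypass_vertices mu nu gamma (s : seq X) :
  (forall x, 0 <= mu x) -> (forall x, 0 <= nu x) ->
  (forall x y, 0 <= gamma x y) ->
  (forall x, outflow gamma x - inflow gamma x = mu x - nu x) ->
  exists gamma',
  [/\ forall x y, 0 <= gamma' x y,
      forall x, outflow gamma' x - inflow gamma' x = mu x - nu x,
      forall z, z \in s -> outflow gamma' z <= mu z,
      forall x, outflow gamma' x <= outflow gamma x &
      \sum_x \sum_y d x y * gamma' x y <= \sum_x \sum_y d x y * gamma x y].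
Proof.
move=> mu_ge0 nu_ge0; elim: s gamma => [|z s IHs] gamma gamma_ge0 bal.
  by exists gamma.
have [g1 [g1_ge0 bal1 out1 outle1 cost1]] :=
  bypass_vertex z mu_ge0 nu_ge0 gamma_ge0 bal.
have [g2 [g2_ge0 bal2 out2 outle2 cost2]] := IHs _ g1_ge0 bal1.
exists g2; split=> // [x|x|]; last exact: le_trans cost2 cost1.
  rewrite inE => /predU1P[->|/out2//]; exact: le_trans (outle2 z) out1.
exact: le_trans (outle2 x) (outle1 x).
Qed.

Lemma kantorovich_le mu nu (gamma : X * X -> R) :
  coupling mu nu gamma -> kantorovich d mu nu <= transport_cost d gamma.
Proof.
move=> cp; apply: ge_inf; last by exists gamma.
exists 0 => _ [g [[g_ge0 _] _ _] ->].
by apply: sumr_ge0 => x _; apply: sumr_ge0 => y _; rewrite mulr_ge0.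
Qed.

(** Once no vertex sends out more than [mu x], the remainder [mu x - outflow g x] is put on the
    diagonal at no cost; the balance equation then gives the second marginal. *)
Lemma kantorovich_le_transshipment mu nu gamma :
  prob_measure mu -> prob_measure nu -> (forall x y, 0 <= gamma x y) ->
  (forall x, \sum_y gamma x y - \sum_y gamma y x = mu x - nu x) ->
  kantorovich d mu nu <= \sum_x \sum_y d x y * gamma x y.
Proof.
move=> [mu_ge0 mu1] [nu_ge0 nu1] gamma_ge0 bal0.
have bal x : outflow gamma x - inflow gamma x = mu x - nu x.
  rewrite -bal0 (bigD1 x) //= [\sum_y gamma y x](bigD1 x) //=.
  by rewrite /outflow /inflow; lra.
have [g [g_ge0 balg outg _ cost]] :=
  bypass_vertices (enum X) mu_ge0 nu_ge0 gamma_ge0 bal.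
pose h (p : X * X) := if p.2 == p.1 then mu p.1 - outflow g p.1 else g p.1 p.2.
have hxx x : h (x, x) = mu x - outflow g x by rewrite /h eqxx.
have hxy x y : y != x -> h (x, y) = g x y by rewrite /h => /negPf /= ->.
have out_h x : \sum_y h (x, y) = mu x.
  by rewrite (bigD1 x) //= hxx (eq_bigr _ (hxy x)) subrK.
have cp : coupling mu nu h.
  split=> // [|y].
    split=> [[x y]|].
      have [->|yx] := eqVneq y x; last by rewrite hxy.
      by rewrite hxx subr_ge0 outg // mem_enum.
    rewrite -mu1 -(eq_bigr _ (fun x _ => out_h x)) pair_bigA.
    by apply: eq_bigr => -[].
  rewrite (bigD1 y) //= hxx (eq_bigr (fun x => g x y)) => [|x xy].
    by have := balg y; rewrite /inflow; lra.
  by rewrite hxy // eq_sym.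
apply: le_trans (kantorovich_le cp) (le_trans _ cost).
apply: ler_sum => x _; apply: ler_sum => y _.
have [->|yx] := eqVneq y x; first by rewrite dxx !mul0r.
by rewrite hxy.
Qed.

End Transshipment.

(** * Cycle cancelling and connectedness of supports *)

Section CycleCancelling.
Variables (R : realType) (X : finType).
Implicit Types (e : rel X) (g : X -> R) (phi chi : X -> X -> R).

(** One unit is sent around the cycle. With at least three vertices, the two orientations of an edge
    cannot cancel. *)
Lemma cycle_circulation e (c : seq X) :
  symmetric e -> ucycle e c -> (2 < size c)%N ->
  exists chi : X -> X -> R,
    is_flow e (fun=> 0) chi /\ exists x y, chi x y != 0.
Proof.
move=> e_sym /andP[cyc uc] c_gt2.
exists (fun x y => ((x \in c) && (y == next c x))%:R
                 - ((y \in c) && (x == next c y))%:R).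
split; first split=> [x y|x y|x].
- by rewrite opprB.
- case: andP => [[xc /eqP->]|_]; first by rewrite (next_cycle cyc).
  case: andP => [[yc /eqP->]|_]; first by rewrite e_sym (next_cycle cyc).
  by rewrite subrr eqxx.
- rewrite big_split sumrN /=; apply/eqP; rewrite subr_eq0; apply/eqP.
  transitivity ((x \in c)%:R : R).
    rewrite (bigD1 (next c x)) //= eqxx andbT big1 ?addr0 // => y /negPf->.
    by rewrite andbF.
  rewrite (bigD1 (prev c x)) //= mem_prev next_prev // eqxx andbT.
  rewrite big1 ?addr0 // => y yx; case: eqP => [xE|_]; last by rewrite andbF.
  by rewrite xE prev_next // eqxx in yx.
case: c c_gt2 uc cyc => [//|a [//|b [//|d s]]] _ uc _; exists a, b.
move: uc; rewrite /= !inE !negb_or => /and3P[/and3P[ab ad _] /andP[bd _] _].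
rewrite !eqxx [b == a]eq_sym (negPf ab) /= (negPf ad).
by rewrite subr0 oner_eq0.
Qed.

Definition support_rel phi : rel X := [rel x y | phi x y != 0].

(** [L chi] is the rate at which the cost of [phi + t * chi] changes for small positive [t]; up to
    the sign of [chi] it is at most 0. The cost stays affine in [t] until some edge of the support
    is emptied, and that edge is the one gained. *)
Lemma cancel_circulation e g (w phi chi : X -> X -> R) :
  (forall x y, e x y -> 0 < w x y) -> is_flow e g phi ->
  is_flow (support_rel phi) (fun=> 0) chi -> (exists x y, chi x y != 0) ->
  exists phi', [/\ is_flow e g phi', flow_cost w phi' <= flow_cost w phi &
    (#|[set p | phi' p.1 p.2 != 0%R]| < #|[set p | phi p.1 p.2 != 0%R]|)%N].
Proof.
move=> w_gt0 phiF.
pose L chi := \sum_x \sum_y w x y * (Num.sg (phi x y) * chi x y).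
wlog L_le0 : chi / L chi <= 0 => [wlogL chiF chi_n0|].
  have [/wlogL|/ltW L_ge0] := leP (L chi) 0; first exact.
  apply: (wlogL (fun x y => -1 * chi x y)).
  - rewrite /L; under eq_bigr do under eq_bigr do rewrite mulN1r !mulrN.
    under eq_bigr do rewrite sumrN.
    by rewrite sumrN oppr_le0.
  - by apply: is_flow_ext (is_flowZ (-1) chiF) => x; rewrite mulr0.
  - have [x [y xy]] := chi_n0; exists x, y.
    by rewrite mulN1r oppr_eq0.
move=> chiF [x0 [y0 chi_n0]].
have chi_phi x y : chi x y != 0 -> phi x y != 0
  by exact: (flow_supp chiF).
have sg_ge0 x y : 0 <= phi x y * chi x y -> 0 <= Num.sg (phi x y) * chi x y.
  by case: (sgrP (phi x y)) => [||]; rewrite ?mul0r ?mul1r ?mulN1r //;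
    nra.
(* Somewhere [chi] opposes [phi]: otherwise all terms of [L chi] would be nonnegative, and the one
   at [(x0, y0)] positive. *)
have [[x1 y1] P1|allP] := pickP (fun p : X * X => phi p.1 p.2 * chi p.1 p.2 < 0);
    last first.
  have pos x y : 0 <= w x y * (Num.sg (phi x y) * chi x y).
    have [chi0|/chi_phi/(flow_supp phiF)/w_gt0/ltW w_ge0] := eqVneq (chi x y) 0.
      by rewrite chi0 !mulr0.
    by rewrite mulr_ge0 // sg_ge0 // leNgt (allP (x, y)).
  suff : 0 < L chi by rewrite ltNge L_le0.
  rewrite /L (bigD1 x0) //= (bigD1 y0) //= ltr_wpDr ?ltr_wpDr ?sumr_ge0 //.
    by move=> i _; rewrite sumr_ge0.
  rewrite lt_def pos andbT !mulf_neq0 ?sgr_eq0 //; last exact: chi_phi.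
  by rewrite gt_eqF // w_gt0 // (flow_supp phiF) // chi_phi.
pose P (p : X * X) := phi p.1 p.2 * chi p.1 p.2 < 0.
pose ratio (p : X * X) := - phi p.1 p.2 / chi p.1 p.2.
case: (@Order.TotalTheory.arg_minP _ _ _ (x1, y1) P ratio P1) => -[x2 y2] P2 min2.
(* The first time at which an entry of [phi] opposed by [chi] vanishes; up to then no entry changes
   sign. *)
set t := ratio (x2, y2) in min2.
have ratioE x y : P (x, y) -> ratio (x, y) * chi x y = - phi x y.
  rewrite /P /ratio /= => xy; rewrite divfK //.
  by apply: contraTneq xy => ->; rewrite mulr0 ltxx.
have t_ge0 : 0 <= t.
  rewrite leNgt; apply/negP => t_lt0.
  have : 0 < t * chi x2 y2 * chi x2 y2 by rewrite ratioE // mulNr oppr_gt0.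
  by rewrite -mulrA -expr2 nmulr_rgt0 // ltNge sqr_ge0.
have same_sign x y : 0 <= phi x y * (phi x y + t * chi x y).
  have [pc|pc] := leP 0 (phi x y * chi x y); first by nra.
  have /(ler_wnM2r (ltW pc)) := min2 (x, y) pc.
  by rewrite mulrCA ratioE //; lra.
have normE x y : `|phi x y + t * chi x y| =
    `|phi x y| + t * (Num.sg (phi x y) * chi x y).
  have := same_sign x y.
  have [phi_gt0|phi_lt0|phi0] := ltgtP 0 (phi x y).
  - rewrite pmulr_rge0 // => /ger0_norm->.
    by rewrite gtr0_sg // gtr0_norm // mul1r.
  - rewrite nmulr_rge0 // => /ler0_norm->.
    by rewrite ltr0_sg // ltr0_norm // mulN1r opprD mulrN.
  - have [->|/chi_phi] := eqVneq (chi x y) 0; last by rewrite -phi0 eqxx.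
    by rewrite !mulr0 !addr0 -phi0.
exists (fun x y => phi x y + t * chi x y); split.
- have chiF' : is_flow e (fun=> 0) chi.
    case: chiF => anti supp div; split=> // x y /supp; exact: (flow_supp phiF).
  apply: is_flow_ext (is_flowD phiF (is_flowZ t chiF')) => x.
  by rewrite mulr0 addr0.
- rewrite /flow_cost.
  under eq_bigr do under eq_bigr do rewrite normE mulrDr mulrCA.
  under eq_bigr do rewrite big_split.
  rewrite big_split /=.
  under [X in _ + X]eq_bigr do rewrite -mulr_sumr.
  by rewrite -mulr_sumr gerDl mulr_ge0_le0.
- apply: proper_card; apply/fintype.properP; split.
    apply/fintype.subsetP => -[x y]; rewrite !inE /=; apply: contraNneq => phi0.
    have [->|/chi_phi] := eqVneq (chi x y) 0; last by rewrite phi0 eqxx.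
    by rewrite phi0 mulr0 addr0.
  exists (x2, y2); rewrite !inE /=.
    by apply: contraTneq P2; rewrite /P /= => ->; rewrite mul0r ltxx.
  by rewrite ratioE // subrr eqxx.
Qed.

(** No flow leaves the component [A] of [x] in the support, so the divergences over [A] sum to zero,
    and non-degeneracy leaves only the whole of [X]. *)
Lemma support_connected e g phi : is_flow e g phi ->
  (forall A : {set X}, A != finset.set0 -> A != [set: X]%SET ->
     \sum_(x in A) g x != 0) ->
  connected_rel (support_rel phi).
Proof.
move=> phiF nondeg x y; pose A := [set z | connect (support_rel phi) x z].
have xA : x \in A by rewrite inE.
have [/setP/(_ y)|AT] := eqVneq A [set: X]%SET; first by rewrite !inE.
have A0 : A != finset.set0 by apply/set0Pn; exists x.
have := nondeg A A0 AT; rewrite (eq_bigr (fun z => \sum_(t in A) phi z t)).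
  by rewrite antisym_sum0 ?eqxx //; exact: (flow_anti phiF).
move=> z; rewrite inE => xz; rewrite -(flow_div phiF) [RHS]big_mkcond.
rewrite [LHS]big_mkcond; apply: eq_bigr => t _; rewrite inE.
case: ifPn => // xt; apply/eqP; apply: contraNT xt => zt.
exact: connect_trans xz (connect1 zt).
Qed.

End CycleCancelling.

(* Among the flows no costlier than a given one, one with minimal support has
   acyclic support by cycle cancelling; it is connected by non-degeneracy. *)
Lemma tree_supported_flow (R : realType) (X : finType) (G : weighted_graph R X)
    (r : X) (g : X -> R) (phi : X -> X -> R) :
  (forall A : {set X}, A != finset.set0 -> A != [set: X]%SET ->
     \sum_(x in A) g x != 0) ->
  is_flow (edge G) g phi ->
  exists (T : rooted_spanning_tree G) (phi' : X -> X -> R),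
    is_flow (tree_edge T) g phi' /\
    flow_cost (weight G) phi' <= flow_cost (weight G) phi.
Proof.
move=> nondeg; have [n] := ubnP #|[set p | phi p.1 p.2 != 0%R]|.
elim: n phi => // n IHn phi; rewrite ltnS => size_phi phiF.
have phi_sym : symmetric (support_rel phi).
  by move=> x y; rewrite /support_rel /= (flow_anti phiF) oppr_eq0.
have [acyc|/existsNP[c /not_implyP[cyc /negP]]] :=
    pselect (acyclic_rel (support_rel phi)).
  exists (RootedSpanningTree r (fun x y => flow_supp phiF (x:=x) (y:=y)) phi_sym
    (support_connected phiF nondeg) acyc), phi.
  by split=> //; case: phiF.
rewrite -ltnNge => /(cycle_circulation R phi_sym cyc)[chi [chiF chi_n0]].
have [phi' [phi'F cost' card']] :=
  cancel_circulation (@weight_gt0 _ _ G) phiF chiF chi_n0.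
have [T [psi [psiF cost]]] := IHn phi' (leq_trans card' size_phi) phi'F.
by exists T, psi; split=> //; exact: le_trans cost cost'.
Qed.

(** * Subadditivity and homogeneity of the flow cost *)

Section FlowCost.
Variables (R : realType) (X : finType) (e : rel X) (w : X -> X -> R).
Hypothesis w_gt0 : forall x y, e x y -> 0 < w x y.

Lemma flow_costD g1 g2 (phi1 phi2 : X -> X -> R) :
  is_flow e g1 phi1 -> is_flow e g2 phi2 ->
  flow_cost w (fun x y => phi1 x y + phi2 x y) <=
  flow_cost w phi1 + flow_cost w phi2.
Proof.
move=> F1 F2; rewrite -big_split; apply: ler_sum => x _.
rewrite -big_split; apply: ler_sum => y _ /=; rewrite -mulrDr.
have [xy|/negP xy] := boolP (e x y).
  by rewrite ler_wpM2l ?ler_normD // ltW ?w_gt0.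
(* Off the edges the sign of [w] is unknown, but both flows vanish there. *)
have phi0 (g : X -> R) phi : is_flow e g phi -> phi x y = 0.
  by move=> phiF; apply/eqP/negPn/negP => /(flow_supp phiF).
by rewrite (phi0 _ _ F1) (phi0 _ _ F2) addr0 normr0 addr0.
Qed.

Lemma flow_costZ (t : R) (phi : X -> X -> R) : 0 <= t ->
  flow_cost w (fun x y => t * phi x y) = t * flow_cost w phi.
Proof.
move=> t_ge0; rewrite mulr_sumr; apply: eq_bigr => x _.
rewrite mulr_sumr; apply: eq_bigr => y _.
by rewrite normrM ger0_norm // mulrCA.
Qed.

Lemma flow_cost_edge (a b : X) : (forall x y, w x y = w y x) -> a != b ->
  flow_cost w
    (fun x y => ((x == a) && (y == b))%:R - ((x == b) && (y == a))%:R)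
  = 2 * w a b.
Proof.
move=> w_sym ab; pose D (c d x y : X) : R := ((x == c) && (y == d))%:R * w c d.
have sumD c d : \sum_x \sum_y D c d x y = w c d.
  rewrite (bigD1 c) //= (bigD1 d) //= /D !eqxx mul1r big1 ?addr0.
    rewrite big1 ?addr0 // => x /negPf->; rewrite big1 // => y _.
    by rewrite mul0r.
  by move=> y /negPf->; rewrite andbF mul0r.
transitivity (\sum_x \sum_y (D a b x y + D b a x y)).
  apply: eq_bigr => x _; apply: eq_bigr => y _; rewrite /D.
  have [/andP[/eqP-> /eqP->]|_] := boolP ((x == a) && (y == b)).
    by rewrite (negPf ab) /= subr0 normr1 mulr1 mul1r mul0r addr0.
  have [/andP[/eqP-> /eqP->]|_] := boolP ((x == b) && (y == a)).
    by rewrite sub0r normrN normr1 mulr1 mul1r mul0r add0r.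
  by rewrite subrr normr0 mulr0 !mul0r addr0.
under eq_bigr do rewrite big_split.
by rewrite big_split /= !sumD (w_sym b a) mulr_natl mulr2n.
Qed.

End FlowCost.

(** * Bounds on Kantorovich distances, and Lipschitz functions for [graph_dist] *)

Section TransportBounds.
Variables (R : realType) (X : finType) (mu nu : X -> R).
Hypotheses (mu_prob : prob_measure mu) (nu_prob : prob_measure nu).

Lemma sum_diff0 : \sum_x (mu x - nu x) = 0.
Proof.
by case: mu_prob nu_prob => [_ m1] [_ n1]; rewrite sumrB m1 n1 subrr.
Qed.

(** Weak duality. The product measure makes the set of costs nonempty, so that a lower bound of the
    set bounds its [inf]. *)
Lemma dual_value_le_kantorovich d (u : X -> R) :
  lipschitz1 d u -> dual_value mu nu u <= kantorovich d mu nu.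
Proof.
move=> lip; apply: lb_le_inf.
  case: mu_prob nu_prob => [m0 m1] [n0 n1].
  exists (transport_cost d (fun p => mu p.1 * nu p.2)).
  exists (fun p => mu p.1 * nu p.2) => //.
  have mu_m x : \sum_y mu x * nu y = mu x by rewrite -mulr_sumr n1 mulr1.
  split=> //=.
    split=> [p|]; first by rewrite mulr_ge0.
    by rewrite -m1 -(eq_bigr _ (fun x _ => mu_m x)) pair_bigA.
  by move=> y; rewrite -mulr_suml m1 mul1r.
move=> _ [gam [[g_ge0 _] margmu margnu] ->].
have -> : dual_value mu nu u = \sum_x \sum_y (u x - u y) * gam (x, y).
  under eq_bigr do under eq_bigr do rewrite mulrBl.
  under eq_bigr do rewrite sumrB -mulr_sumr margmu.
  rewrite sumrB exchange_big /=.
  under [X in _ - X]eq_bigr do rewrite -mulr_sumr margnu.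
  by rewrite -sumrB; apply: eq_bigr => x _; rewrite mulrBr.
apply: ler_sum => x _; apply: ler_sum => y _.
by rewrite ler_wpM2r // (le_trans (ler_norm _)).
Qed.

Variable G : weighted_graph R X.

Lemma kantorovich_le_flow_cost (T : rooted_spanning_tree G) (phi : X -> X -> R) :
  is_flow (tree_edge T) (fun x => mu x - nu x) phi ->
  2 * kantorovich (tree_dist T) mu nu <= flow_cost (weight G) phi.
Proof.
(* The positive part of [phi] serves as a transshipment plan. It lives on tree edges, where the tree
   distance is the weight. *)
move=> phiF; pose gam x y := (`|phi x y| + phi x y) / 2.
have gam_ge0 x y : 0 <= gam x y.
  by rewrite divr_ge0 //; have := lerNnormlW (lexx `|phi x y|); lra.
have := kantorovich_le_transshipment (@tree_distxx _ _ _ T) (@tree_dist_ge0 _ _ _ T)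
  (@tree_dist_triangle _ _ _ T) mu_prob nu_prob gam_ge0.
have -> : \sum_x \sum_y tree_dist T x y * gam x y = flow_cost (weight G) phi / 2.
  transitivity (\sum_x \sum_y (weight G x y * `|phi x y| + weight G x y * phi x y) / 2).
    apply: eq_bigr => x _; apply: eq_bigr => y _; rewrite /gam.
    have [->|/(flow_supp phiF)/tree_dist_edge->] := eqVneq (phi x y) 0.
      by rewrite normr0 !mulr0 !addr0 !mul0r mulr0.
    by rewrite -mulrDr mulrA.
  under eq_bigr do rewrite -mulr_suml big_split.
  rewrite -mulr_suml big_split /= [X in _ + X](antisym_sum0 predT) ?addr0 //.
  by move=> x y; rewrite (weight_sym G) (flow_anti phiF) mulrN.
move=> h; suff : kantorovich (tree_dist T) mu nu <= flow_cost (weight G) phi / 2 by lra.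
apply: h => x; rewrite -(flow_div phiF) -sumrB; apply: eq_bigr => y _.
by rewrite /gam (flow_anti phiF x y) normrN; lra.
Qed.

(** An edge is itself a simple path; conversely, bounds on edges add up along every path.
    Connectedness makes the infimum range over a nonempty set. *)
Lemma lipschitz_graph_dist (v : X -> R) : connected_rel (edge G) ->
  lipschitz1 (graph_dist G) v <->
  (forall a b, edge G a b -> `|v a - v b| <= weight G a b).
Proof.
move=> connG; split=> [lip a b ab|lip x y].
  apply: le_trans (lip a b) _; apply: ge_inf; last first.
    exists [:: b] => /=; last by rewrite addr0.
    apply/and3P; split=> //=; rewrite ?ab // inE andbT.
    by apply: contraTneq ab => ->; rewrite edge_irr.
  exists 0 => _ [p /and3P[pp _ _] ->]; apply: path_length_ge0 pp => c d.
  by move=> /weight_gt0/ltW.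
apply: lb_le_inf.
  have /connectP[p0 /shortenP[p pp up _] yE] := connG x y.
  exists (path_length (weight G) x p), p => //.
  by apply/and3P; split=> //; rewrite yE.
move=> _ [p /and3P[pp _ /eqP<-] ->]; exact: path_length_ge_diff pp.
Qed.

End TransportBounds.

(** * The potential of an optimal tree *)

Section TreePotential.
Variables (R : realType) (X : finType) (G : weighted_graph R X).
Variables (mu nu : X -> R).
Hypotheses (mu_prob : prob_measure mu) (nu_prob : prob_measure nu).
Hypothesis nondeg : weakly_nondegenerate mu nu.
Local Notation f := (fun x => mu x - nu x).

Lemma nondeg_sum (A : {set X}) :
  A != finset.set0 -> A != [set: X]%SET -> \sum_(x in A) f x != 0.
Proof. by move=> A0 AT; rewrite sumrB subr_eq0; exact: nondeg. Qed.

Lemma exists_vertex : exists r : X, True.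
Proof.
have [r _|X0] := pickP (@predT X); first by exists r.
by case: mu_prob => _; rewrite big_pred0 // => /esym/eqP; rewrite oner_eq0.
Qed.

(* K_{d_T} depends on T through its edge set only, so the minimum is over
   finitely many values. *)
Lemma exists_optimal_tree : connected_rel (edge G) ->
  exists T : rooted_spanning_tree G, optimal_tree mu nu T.
Proof.
move=> connG; have [r _] := exists_vertex.
have [phi phiF] := exists_flow (@edge_sym _ _ G) connG (sum_diff0 mu_prob nu_prob).
have [T0 _] := tree_supported_flow r nondeg_sum phiF.
(* Edge relations are coded as sets of pairs, which form a finite type, and [K] expresses the
   Kantorovich distance for a tree through its edge relation alone. *)
pose erel (s : {set X * X}) : rel X := fun x y => (x, y) \in s.
pose P s := `[< exists T : rooted_spanning_tree G, tree_edge T = erel s >].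
pose K (e : rel X) := kantorovich (fun x y => path_length (weight G) x
  (xget [::] [set p : seq X | simple_path e x y p]%classic)) mu nu.
have erelE (T : rooted_spanning_tree G) :
    tree_edge T = erel [set p | tree_edge T p.1 p.2]%SET.
  by apply/funext => x; apply/funext => y; rewrite /erel inE.
have PT (T : rooted_spanning_tree G) : P [set p | tree_edge T p.1 p.2]%SET.
  by apply/asboolP; exists T.
case: (Order.TotalTheory.arg_minP (fun s => K (erel s)) (PT T0)).
move=> s /asboolP[T TE] min_s; exists T => T'.
have := min_s _ (PT T'); rewrite -erelE -TE; exact.
Qed.

Variable T : rooted_spanning_tree G.
Local Notation r := (Defs.root T).
Local Notation w := (weight G).
Local Notation Xi := (subtree_sum T f).

(** The descendants of [x] form a nonempty proper subset: they include [x] but not the root. *)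
Lemma subtree_sum_neq0 (x : X) : x != r -> Xi x != 0.
Proof.
move=> xr; rewrite /subtree_sum.
rewrite (eq_bigl [in [set z | descendant T z x]%SET]) => [|z]; last by rewrite inE.
apply: nondeg_sum; first by apply/set0Pn; exists x; rewrite inE descendant_refl.
apply/eqP => /setP/(_ r); rewrite !inE descendant_root => /eqP xr'.
by rewrite xr' eqxx in xr.
Qed.

Lemma dual_value_tree (v : X -> R) : dual_value mu nu v =
  \sum_(x | x != r) (v x - v (parent T x)) * Xi x.
Proof. exact/sum_by_parts/sum_diff0. Qed.

Lemma dual_value_le_tree_cost (v : X -> R) :
  (forall x, x != r -> `|v x - v (parent T x)| <= w x (parent T x)) ->
  dual_value mu nu v <= tree_cost T f.
Proof.
move=> lip; rewrite dual_value_tree; apply: ler_sum => x /lip lipx.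
by rewrite (le_trans (ler_norm _)) // normrM ler_wpM2r.
Qed.

Variable b : bool.
Local Notation u := (tree_potential T mu nu b).

(** Since [Xi x] is nonzero, [pm_sgn b] agrees here with the usual sign for either [b]. *)
Lemma tree_potential_parent (x : X) : x != r ->
  u x - u (parent T x) = w x (parent T x) * Num.sg (Xi x).
Proof.
move=> xr; rewrite /tree_potential sum_descendant_parent // addrK.
rewrite tree_dist_parent // /pm_sgn.
by have /negPf := subtree_sum_neq0 xr; rewrite /tree_flow => ->.
Qed.

Lemma tree_potential_norm (x : X) : x != r ->
  `|u x - u (parent T x)| <= w x (parent T x).
Proof.
move=> xr; rewrite tree_potential_parent // normrM normr_sg subtree_sum_neq0 //.
by rewrite mulr1 ger0_norm // (weight_tree_ge0 (tree_edge_parent xr)).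
Qed.

Lemma lipschitz_tree_potential : lipschitz1 (tree_dist T) u.
Proof.
move=> x y; have /and3P[pp _ /eqP yE] := tree_pathP T x y.
rewrite /tree_dist -{1}yE; apply: path_length_ge_diff pp => c d.
case/tree_edge_cases => -[ncr ->]; first exact: tree_potential_norm.
by rewrite distrC (weight_sym G); exact: tree_potential_norm.
Qed.

Lemma dual_value_tree_potential : dual_value mu nu u = tree_cost T f.
Proof.
rewrite dual_value_tree; apply: eq_bigr => x xr.
by rewrite tree_potential_parent // -mulrA -normrEsg.
Qed.

(** The gaps between the terms of C(T) and those of the dual value are nonnegative, so all vanish.
    Cancelling [Xi x] shows that [v] and [u] have the same increments along the tree. *)
Lemma eq_tree_potential (v : X -> R) :
  (forall x, x != r -> `|v x - v (parent T x)| <= w x (parent T x)) ->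
  tree_cost T f <= dual_value mu nu v -> exists c, forall y, v y = u y + c.
Proof.
move=> lip; rewrite dual_value_tree => cost_le.
have gap_ge0 x : x != r ->
    0 <= w x (parent T x) * `|Xi x| - (v x - v (parent T x)) * Xi x.
  move=> /lip lipx; rewrite subr_ge0 (le_trans (ler_norm _)) //.
  by rewrite normrM ler_wpM2r.
have gap0 : \sum_(x | x != r)
    (w x (parent T x) * `|Xi x| - (v x - v (parent T x)) * Xi x) = 0.
  by apply/eqP; rewrite eq_le sumr_ge0 // andbT sumrB subr_le0.
exists (v r - u r); elim/(@tree_ind _ _ _ T) => [|y yr IHy]; first by lra.
have /eqP := psumr_eq0P gap_ge0 gap0 yr; rewrite subr_eq0 normrEsg mulrA.
rewrite -tree_potential_parent // => /eqP /(mulIf (subtree_sum_neq0 yr)).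
by lra.
Qed.

Hypothesis optT : optimal_tree mu nu T.

(** C(T) is the dual value of [u], hence at most K_{d_T} by weak duality, hence at most K_{d_T'} for
    a tree [T'] carrying a flow no costlier than [phi]. *)
Lemma optimal_tree_cost_le (phi : X -> X -> R) :
  is_flow (edge G) f phi -> 2 * tree_cost T f <= flow_cost w phi.
Proof.
move=> /(tree_supported_flow r nondeg_sum)[T' [psi [psiF cost]]].
apply: le_trans cost; apply: le_trans (kantorovich_le_flow_cost _ _ psiF) => //.
rewrite ler_pM2l //; apply: le_trans (optT T').
rewrite -dual_value_tree_potential.
exact: dual_value_le_kantorovich lipschitz_tree_potential.
Qed.

(** The difference does not cross 0, so the absolute value is affine there and the first-order
    expansion of the cost is exact. *)
Lemma normB_small (p q : R) : p != 0 -> `|q| <= `|p| ->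
  `|p - q| = `|p| - Num.sg p * q.
Proof.
rewrite neq_lt => /orP[p0|p0]; rewrite ler_norml.
  by rewrite ltr0_sg // ltr0_norm // => /andP[? ?]; rewrite ler0_norm; lra.
by rewrite gtr0_sg // gtr0_norm // => /andP[? ?]; rewrite ger0_norm; lra.
Qed.

(* Sending a small extra amount through the edge {a, c} and back along the tree
   changes the cost at rate w a c - (u a - u c). *)
Lemma optimal_tree_potential_edge (a c : X) : edge G a c -> u a - u c <= w a c.
Proof.
move=> ac; have ac_neq : a != c by apply: contraTneq ac => ->; rewrite edge_irr.
pose h x : R := (x == a)%:R - (x == c)%:R.
have sum_h (v : X -> R) : \sum_x v x * h x = v a - v c.
  under eq_bigr do rewrite mulrC mulrBl.
  by rewrite sumrB !sum_pick_eq.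
have h0 : \sum_x h x = 0.
  by under eq_bigr do rewrite -[h _]mul1r; rewrite (sum_h (fun=> 1)) subrr.
(* The sum dominates each ratio, so [eps = D^-1] suits all vertices at once; the 1 keeps [D]
   positive. *)
pose D := 1 + \sum_(x | x != r) `|subtree_sum T h x| / `|Xi x|.
have D_gt0 : 0 < D by rewrite ltr_pwDl // sumr_ge0 // => x _; rewrite divr_ge0.
pose eps := D^-1; have eps_gt0 : 0 < eps by rewrite invr_gt0.
have eps_le x : x != r -> `|eps * subtree_sum T h x| <= `|Xi x|.
  move=> xr; rewrite normrM gtr0_norm // mulrC ler_pdivrMr //.
  rewrite -ler_pdivrMl ?normr_gt0 ?subtree_sum_neq0 //.
  rewrite /D (bigD1 x) //= mulrC addrCA lerDl addr_ge0 // sumr_ge0 // => y _.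
  by rewrite divr_ge0.
(* The edge from [a] to [c] carries [eps], and the tree carries the remaining divergence [g]. *)
pose g x := f x - eps * h x.
have g0 : \sum_x g x = 0.
  by rewrite sumrB sum_diff0 // -mulr_sumr h0 mulr0 subr0.
have Xi_g x : subtree_sum T g x = Xi x - eps * subtree_sum T h x.
  by rewrite /subtree_sum sumrB mulr_sumr.
have cost_g : tree_cost T g = tree_cost T f - eps * (u a - u c).
  rewrite -sum_h (sum_by_parts T) // mulr_sumr -sumrB; apply: eq_bigr => x xr.
  rewrite Xi_g normB_small ?subtree_sum_neq0 ?eps_le // tree_potential_parent //.
  by ring.
have treeF : is_flow (edge G) g (parent_flow T (subtree_sum T g)).
  by case: (parent_flowP T g0) => anti supp div; split=> // x y /supp/tree_sub.
have edgeF := is_flowZ eps (is_flow_edge R (@edge_sym _ _ G) ac).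
have gE x : g x + eps * h x = f x by rewrite subrK.
have := optimal_tree_cost_le (is_flow_ext gE (is_flowD treeF edgeF)).
move=> /le_trans/(_ (flow_costD (@weight_gt0 _ _ G) treeF edgeF)).
rewrite flow_costZ ?flow_cost_edge ?(ltW eps_gt0) //; last exact: weight_sym.
(* Together the bounds read [2 * C <= 2 * (C - eps * (u a - u c)) + 2 * eps * w a c], with
   [C = tree_cost T f]. *)
move=> le1; have := sum_parent_flow_cost T (subtree_sum T g).
rewrite -/(tree_cost T g) cost_g => le2.
rewrite -(ler_pM2l eps_gt0); lra.
Qed.

Lemma optimal_tree_potential_lipschitz (a c : X) :
  edge G a c -> `|u a - u c| <= w a c.
Proof.
move=> ac; rewrite ler_norml optimal_tree_potential_edge // andbT.
have : edge G c a by rewrite edge_sym.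
by move=> /optimal_tree_potential_edge; rewrite (weight_sym G); lra.
Qed.

(** C(T) bounds the dual value of every admissible function and [u] attains it, so the potentials
    are exactly the functions in the equality case. *)
Lemma optimal_tree_potentials (v : X -> R) : connected_rel (edge G) ->
  kantorovich_potential (graph_dist G) mu nu v <->
  exists c, forall y, v y = u y + c.
Proof.
move=> connG.
have lip_parent v' : lipschitz1 (graph_dist G) v' ->
    forall x, x != r -> `|v' x - v' (parent T x)| <= w x (parent T x).
  move=> /(lipschitz_graph_dist v' connG) lip x /tree_edge_parent/tree_sub.
  exact: lip.
have lip_u : lipschitz1 (graph_dist G) u.
  exact/lipschitz_graph_dist/optimal_tree_potential_lipschitz.
split=> [[lip_v max_v]|[c vE]].
  apply: eq_tree_potential; first exact: lip_parent.
  by rewrite -dual_value_tree_potential; exact: max_v.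
have -> : v = fun y => u y + c by apply/funext.
split=> [x y|v' lip_v']; first by rewrite opprD addrACA subrr addr0 lip_u.
have -> : dual_value mu nu (fun y => u y + c) = dual_value mu nu u.
  rewrite /dual_value; under eq_bigr do rewrite mulrDl.
  by rewrite big_split /= -mulr_sumr sum_diff0 // mulr0 addr0.
rewrite dual_value_tree_potential; exact/dual_value_le_tree_cost/lip_parent.
Qed.

End TreePotential.

Theorem theorem3p3 (R : realType) (X : finType) (G : weighted_graph R X)
    (mu nu : X -> R)
    (connG : connected_rel (edge G))
    (mu_prob : prob_measure mu) (nu_prob : prob_measure nu)
    (nondeg : weakly_nondegenerate mu nu) :
  [/\ exists u : X -> R, kantorovich_potential (graph_dist G) mu nu u,
      forall u v : X -> R,
        kantorovich_potential (graph_dist G) mu nu u ->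
        kantorovich_potential (graph_dist G) mu nu v ->
        exists c : R, forall y : X, u y = v y + c &
      forall (T : rooted_spanning_tree G) (b : bool),
        optimal_tree mu nu T ->
        forall u : X -> R,
          kantorovich_potential (graph_dist G) mu nu u <->
          exists c : R, forall y : X, u y = tree_potential T mu nu b y + c].
Proof.
have potP (T : rooted_spanning_tree G) b : optimal_tree mu nu T -> forall u,
    kantorovich_potential (graph_dist G) mu nu u <->
    exists c : R, forall y : X, u y = tree_potential T mu nu b y + c.
  by move=> optT u; exact: optimal_tree_potentials.
(* Existence and uniqueness follow from the characterization at a single optimal tree, with either
   value of the sign at 0. *)
have [T optT] := exists_optimal_tree mu_prob nu_prob nondeg connG.
split=> // [|u v /(potP _ false optT)[c uE] /(potP _ false optT)[d vE]].
  exists (tree_potential T mu nu false); apply/(potP _ _ optT).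
  by exists 0 => y; rewrite addr0.
by exists (c - d) => y; rewrite uE vE; lra.
Qed.
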